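(* Let $j$, $r$, $m_0$ be positive integers with $j<r$. Suppose that $(r-1)(m-1)+1\leq g(m,j)< r(m-1)$ for every integer $m\geq m_0$ (with $m\ge 2$). Then $$(3r-j-1)(m-1)+1 < g(m,r)\leq (3r-j)(m-1)$$ for every integer $m\geq m_0$ (with $m\geq 2$).
   Context: For positive integers $m$ and $r$, $g(m,r)$ denotes the least positive integer $N$ such that for every map $\Delta:\{1,2,\ldots,N\}\to\{1,2,\ldots,r\}$ there exist $2m$ integers $x_1<\cdots<x_m<y_1<\cdots<y_m$ in $\{1,\ldots,N\}$ with $\Delta(x_1)=\cdots=\Delta(x_m)$, $\Delta(y_1)=\cdots=\Delta(y_m)$, and $2(x_m-x_1)\leq y_m-x_1$. *)

(* Defs.v *)
From mathcomp Require Import all_boot zify.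
From mathcomp Require Import boolp.

Set Implicit Arguments.
Unset Strict Implicit.
Unset Printing Implicit Defensive.

(* A colouring of {1, ..., N} with r colours is given by D : nat -> 'I_r, of
   which only the values on {1, ..., N} matter.  The sequences x and y hold
   x_1 < ... < x_m and y_1 < ... < y_m; for m > 0 the subtractions are not
   truncated, because x ++ y is increasing. *)
Definition unavoidable (m r N : nat) : Prop :=
  forall D : nat -> 'I_r, exists x y : seq nat,
    [/\ size x = m /\ size y = m,
        sorted ltn (x ++ y),
        all (fun i => 1 <= i <= N) (x ++ y),
        constant (map D x) /\ constant (map D y)
      & 2 * (last 0 x - head 0 x) <= last 0 y - head 0 x].

Lemma mono_block (r m a : nat) (D : nat -> 'I_r) :
  exists s : seq nat,
    [/\ size s = m, sorted ltn s,
        all (fun i => a <= i < a + (r * m.-1).+1) s & constant (map D s)].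
Proof.
pose K := (r * m.-1).+1.
pose cls c := [seq i <- iota a K | D i == c].
have [c hc] : exists c, m <= size (cls c).
  case: (boolP [exists c, m <= size (cls c)]) => [/existsP //|].
  rewrite negb_exists => /forallP hlt; exfalso; move: (ltnn K) => /negP; apply.
  have hle : \sum_(c < r) size (cls c) <= r * m.-1.
    rewrite -[X in X * _]card_ord -sum_nat_const; apply: leq_sum => c _.
    by have := hlt c; rewrite -ltnNge; lia.
  suff hK : \sum_(c < r) size (cls c) = K by rewrite -{1}hK /K ltnS.
  under eq_bigr => c _ do rewrite size_filter -sum1_count.
  rewrite (exchange_big_dep xpredT) //=.
  under eq_bigr => i _ do rewrite (big_pred1 (D i)) //.
  by rewrite sum1_size /= size_iota.
have hsub : subseq (take m (cls c)) (iota a K).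
  by apply: (subseq_trans (take_subseq _ _)); apply: filter_subseq.
exists (take m (cls c)); split.
- by rewrite size_takel.
- exact: (subseq_sorted ltn_trans hsub (iota_ltn_sorted _ _)).
- by apply/allP => i /(mem_subseq hsub); rewrite mem_iota.
- apply/(@constantP _ c); exists c.
  apply/all_pred1P/allP => _ /mapP[i /mem_take + ->].
  by rewrite mem_filter => /andP[].
Qed.

Lemma unavoidable_exists (m r : nat) :
  exists N, `[< 0 < N /\ unavoidable m r N >].
Proof.
pose K := (r * m.-1).+1.
have K0 : 0 < K by [].
exists (4 * K); apply/asboolP; split=> // D.
have [x [sx ox ax cx]] := mono_block m 1 D.
have [y [sy oy ay cy]] := mono_block m (1 + 3 * K) D.
rewrite -/K in ax ay; move: K K0 ax ay => K K0 ax ay.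
exists x, y; split=> //.
- case: x y sx ox ax sy oy ay {cx cy} => [|x0 x] [|y0 y] //= sx ox ax sy oy ay;
    do ?by rewrite ?cats0.
  rewrite cat_path ox /= oy andbT.
  have := allP (ax : all _ (x0 :: x)) _ (mem_last x0 x).
  by move: ay => /andP[+ _] /=; lia.
- rewrite all_cat; apply/andP; split.
    by apply: sub_all ax => i; lia.
  by apply: sub_all ay => i; lia.
- case: x y sx ax sy ay {ox oy cx cy} => [|x0 x] [|y0 y] //= sx ax sy ay;
    try by move: sx sy; lia.
  have := allP (ax : all _ (x0 :: x)) _ (mem_last x0 x).
  have := allP (ay : all _ (y0 :: y)) _ (mem_last y0 y).
  by move: ax => /andP[+ _] /=; lia.
Qed.

Definition g (m r : nat) : nat := ex_minn (unavoidable_exists m r).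

(* Main.v *)
Require Import Defs.
From mathcomp Require Import all_boot.
From mathcomp Require Import zify boolp.

(* Write M = m - 1.  Upper bound: the first rM + 1 integers contain a
   monochromatic x with 2 x_m - x_1 <= 2rM + 1, so every colour met after 2rM may
   be assumed to occur at most M times after rM + 1.  If t colours are met there,
   at most (t + j - r)M points of the window [rM + 2, 2rM] carry one of them;
   giving these points t + j - r fresh colours, each used at most M times, turns
   the window into a j-coloured interval of length rM - 1 >= g(m, j), and the
   pair found in it cannot use a fresh colour.

   Lower bound: let A be a j-colouring of length (r - 1)M without a pair, let
   c^M denote M consecutive points of colour c, and let B list, in the order of A,
   the first M occurrences of each of the j colours, padded to exactly M each.
   The colouring
     r, B, (j+1)^M, ..., r^M, A, (j+1)^M, ..., r^M
   of length (3r - j - 1)M + 1 has no pair: y must lie in A, and x must end no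
   earlier than position rM + 1.  If x ends at rM + 1 it starts at 1; if x starts
   in B, the choice of B forces it to end at least as far inside A; in both cases
   2 x_m - x_1 exceeds the last position of A. *)

Set Implicit Arguments.
Unset Strict Implicit.
Unset Printing Implicit Defensive.

(* The membership and sortedness hypotheses are useless for [lia] and slow it
   down: each becomes a 0/1 unknown to split on. *)
Ltac slia :=
  repeat match goal with
  | H : is_true (_ \in _) |- _ => clear H
  | H : is_true (uniq _) |- _ => clear H
  | H : is_true (sorted _ _) |- _ => clear H
  | H : is_true (all _ _) |- _ => clear H
  | H : is_true (constant _) |- _ => clear H
  end; lia.

(** * Increasing lists, monochromatic lists and monotonicity of [unavoidable] *)

Lemma sorted_ltn_head s i : sorted ltn s -> i \in s -> head 0 s <= i.
Proof.
case: s => //= a s; rewrite path_sortedE; last exact: ltn_trans.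
by move=> /andP[/allP h _]; rewrite inE => /predU1P[->//|/h /ltnW].
Qed.

Lemma sorted_ltn_last s i : sorted ltn s -> i \in s -> i <= last 0 s.
Proof.
elim/last_ind: s => // s a _; rewrite last_rcons -cats1.
rewrite (sorted_pairwise ltn_trans) pairwise_cat => /and3P[/allrelP h _ _].
rewrite mem_cat inE => /orP[hi|/eqP->//].
by apply: ltnW; apply: h => //; rewrite inE.
Qed.

Lemma mem_head0 (s : seq nat) : 0 < size s -> head 0 s \in s.
Proof. by case: s => //= a s _; rewrite inE eqxx. Qed.

Lemma mem_last0 (s : seq nat) : 0 < size s -> last 0 s \in s.
Proof. by case: s => //= a s _; apply: mem_last. Qed.

Lemma constant_map_eq (T : eqType) (D : nat -> T) (s : seq nat) i k :
  constant (map D s) -> i \in s -> k \in s -> D i = D k.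
Proof.
move=> /(constantP (D i))[d e] hi hk.
have /(congr1 (fun t => nth (D i) t (index i s))) := e.
have /(congr1 (fun t => nth (D i) t (index k s))) := e.
rewrite !nth_nseq size_map !index_mem hi hk.
by rewrite !(nth_map 0) ?index_mem // !nth_index // => -> ->.
Qed.

Lemma constant_mapP (T : eqType) (D : nat -> T) (s : seq nat) d :
  (forall i, i \in s -> D i = d) -> constant (map D s).
Proof.
move=> h; apply/(constantP d); exists d.
by apply/all_pred1P/allP => _ /mapP[i /h + ->] => ->; rewrite /= eqxx.
Qed.

Lemma size_le_count (P : pred nat) (s : seq nat) a n : uniq s ->
  (forall i, i \in s -> a <= i < a + n /\ P i) -> size s <= count P (iota a n).
Proof.
move=> us h; rewrite -size_filter; apply: uniq_leq_size => // i /h[ha hP].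
by rewrite mem_filter hP mem_iota.
Qed.

Lemma unavoidable_widen m r N N' :
  N <= N' -> unavoidable m r N -> unavoidable m r N'.
Proof.
move=> le h D; have [x [y [hs hc ha hD hl]]] := h D.
by exists x, y; split=> //; apply: sub_all ha => i; lia.
Qed.

Lemma unavoidable_g m r : unavoidable m r (g m r).
Proof. by rewrite /g; case: ex_minnP => n /asboolP[]. Qed.

Lemma g_le m r N : 0 < N -> unavoidable m r N -> g m r <= N.
Proof.
by move=> N0 h; rewrite /g; case: ex_minnP => n _; apply; apply/asboolP.
Qed.

(** * Recolouring an interval with fresh colours *)

Section Recolouring.

Variables (r M : nat) (D : nat -> 'I_r) (a n : nat) (C : {set 'I_r}).

Definition hole i := D i \in C.

Definition hole_rank i := count hole (iota a (i - a)).

Lemma hole_rank_lt i k : a <= i < k -> hole i -> hole_rank i < hole_rank k.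
Proof.
move=> hik hi; rewrite /hole_rank.
have -> : k - a = (i - a) + (1 + (k - i.+1)) by lia.
rewrite !iotaD !count_cat /= subnKC; last lia.
by rewrite hi; lia.
Qed.

Lemma hole_rank_total i : a <= i < a + n -> hole i ->
  hole_rank i < count hole (iota a n).
Proof.
move=> hi hh; have := @hole_rank_lt i (a + n).
by rewrite {2}/hole_rank addKn; apply.
Qed.

(* Colours outside [C] keep their own name; the holes are cut, in increasing
   order, into consecutive groups of [M], each receiving a fresh colour. *)
Definition recolour i :=
  if hole i then #|~: C| + hole_rank i %/ M else index (D i) (enum (~: C)).

Lemma recolour_lt s i : 0 < M -> count hole (iota a n) <= s * M ->
  a <= i < a + n -> recolour i < #|~: C| + s.
Proof.
move=> M0 hs hi; rewrite /recolour; case: ifP => [hh|/negbT hh].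
  by rewrite ltn_add2l ltn_divLR //; apply: leq_trans (hole_rank_total hi hh) hs.
by rewrite ltn_addr // cardE index_mem mem_enum inE.
Qed.

(** More than [M] points of one new colour contain no hole: holes sharing a fresh colour have ranks
    in one interval of length [M], and [hole_rank] is injective on holes. Off the holes, [index]
    recovers the old colour. *)
Lemma recolour_mono (s : seq nat) : 0 < M -> M < size s -> uniq s ->
  (forall i, i \in s -> a <= i) ->
  (forall i k, i \in s -> k \in s -> recolour i = recolour k) ->
  forall i k, i \in s -> k \in s -> D i = D k.
Proof.
move=> M0 hM us ha hc.
have classic i : ~~ hole i -> recolour i < #|~: C|.
  by rewrite /recolour => hi; rewrite (negbTE hi) cardE index_mem mem_enum inE.
have nonhole i : i \in s -> ~~ hole i.
  move=> hi; apply/negP => hh; move: hM; apply/negP; rewrite -leqNgt.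
  have allh k : k \in s -> hole k.
    move=> hk; apply/negPn/negP => /classic.
    by rewrite -(hc _ _ hi hk) /recolour hh ltnNge leq_addr.
  rewrite -(size_map hole_rank) -(size_iota (hole_rank i %/ M * M) M).
  apply: uniq_leq_size.
    rewrite map_inj_in_uniq // => k l hk hl e.
    have := ha _ hk; have := ha _ hl => al ak.
    case: (ltngtP k l) => // lt; exfalso.
      by have := @hole_rank_lt k l; rewrite ak lt e ltnn => /(_ isT (allh _ hk)).
    by have := @hole_rank_lt l k; rewrite al lt e ltnn => /(_ isT (allh _ hl)).
  move=> _ /mapP[k hk ->]; rewrite mem_iota.
  have := hc _ _ hi hk; rewrite /recolour hh allh // => /addnI ->.
  by rewrite {2 3}(divn_eq (hole_rank k) M) leq_addr ltn_add2l ltn_mod.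
move=> i k hi hk; have := hc _ _ hi hk; rewrite /recolour.
rewrite (negbTE (nonhole _ hi)) (negbTE (nonhole _ hk)).
have mem l : l \in s -> D l \in enum (~: C).
  by move=> /nonhole hl; rewrite mem_enum inE.
by move=> e; rewrite -(nth_index (D i) (mem _ hi)) e nth_index // mem.
Qed.

End Recolouring.

(** * The upper bound *)

Lemma count_setE (I : Type) (T : finType) (D : I -> T) (C : {set T})
    (s : seq I) :
  count (fun i => D i \in C) s = \sum_(d in C) count (fun i => D i == d) s.
Proof.
elim: s => /= [|i s ->]; first by rewrite big1.
rewrite big_split /=; congr (_ + _).
case: (boolP (D i \in C)) => h.
  rewrite (bigD1 (D i)) //= eqxx big1 // => d /andP[_ /negbTE].
  by rewrite eq_sym => ->.
by rewrite big1 // => d hd; case: eqP => // e; rewrite e hd in h.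
Qed.

Lemma unavoidable_upper j r M : 0 < j -> j <= r -> 0 < M ->
  unavoidable M.+1 j (r * M).-1 -> unavoidable M.+1 r ((3 * r - j) * M).
Proof.
move=> j0 jr M0 hJ D; apply: contrapT => hno.
have rM : M <= r * M by nia.
have jrM : j * M <= r * M by nia.
set N := (3 * r - j) * M in hno *.
have NE : N = 2 * (r * M) + (r - j) * M.
  by rewrite /N mulnA -mulnDl; congr (_ * _); slia.
have rjM : (r - j) * M <= r * M by nia.
have [x [sx ox ax cx]] := mono_block M.+1 1 D; rewrite /= in ax.
have x0 : 0 < size x by rewrite sx.
have hx0 := allP ax _ (mem_head0 x0); have hx1 := allP ax _ (mem_last0 x0).
pose a := r * M + 2.
pose C := [set D (2 * (r * M) + k.+1) | k : 'I_((r - j) * M)].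
have tailC i : 2 * (r * M) < i <= N -> D i \in C.
  move=> hi; have hk : i - (2 * (r * M)).+1 < (r - j) * M by slia.
  by apply/imsetP; exists (Ordinal hk) => //=; congr D; slia.
(* Otherwise the last [M.+1] such points form a [y] ending after 2rM, and 2 x_m - x_1 <= 2rM + 1
   makes [x], [y] a pair excluded by [hno]. *)
have few d : d \in C ->
    count (fun i => D i == d) (iota a (N.+1 - a)) <= M.
  case/imsetP => k _ dE; rewrite leqNgt; apply/negP => hM.
  set w := filter (fun i => D i == d) (iota a (N.+1 - a)).
  have sw : M < size w by rewrite size_filter.
  have mw i : (i \in w) = (D i == d) && (a <= i <= N).
    by rewrite mem_filter mem_iota; congr (_ && _); slia.
  have ow : sorted ltn w.
    by apply: sorted_filter; [exact: ltn_trans | exact: iota_ltn_sorted].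
  pose y := drop (size w - M.+1) w.
  have sy : size y = M.+1 by rewrite size_drop; slia.
  have y0 : 0 < size y by rewrite sy.
  have yw i : i \in y -> i \in w by apply: mem_drop.
  have hlast : 2 * (r * M) < last 0 y.
    have -> : last 0 y = last 0 w.
      by rewrite -[in RHS](cat_take_drop (size w - M.+1) w) last_cat -/y; case: (y) y0.
    have : 2 * (r * M) + k.+1 \in w.
      by rewrite mw -dE eqxx /=; have := ltn_ord k; slia.
    by move/(sorted_ltn_last ow); slia.
  apply: hno; exists x, y; split=> //.
  - rewrite (sorted_pairwise ltn_trans) pairwise_cat -!(sorted_pairwise ltn_trans).
    rewrite ox drop_sorted // !andbT; apply/allrelP => i l /(allP ax) hi /yw.
    by rewrite mw /a => /andP[_]; slia.
  - rewrite all_cat; apply/andP; split; apply/allP => i.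
      by move=> /(allP ax); slia.
    by move=> /yw; rewrite mw /a => /andP[_]; slia.
  - by split=> //; apply: (@constant_mapP _ _ _ d) => i /yw; rewrite mw => /andP[/eqP].
  - slia.
pose n := (r * M).-1.
have split_iota : iota a (N.+1 - a) = iota a n ++ iota (a + n) ((r - j) * M).
  by rewrite -iotaD; congr iota; rewrite /a /n; slia.
(* Each colour of [C] has at most [M] points in window and tail together, and all (r - j)M points of
   the tail carry such a colour. *)
have holes : count (hole D C) (iota a n) + (r - j) * M <= #|C| * M.
  have -> : (r - j) * M = count (hole D C) (iota (a + n) ((r - j) * M)).
    rewrite -{1}(size_iota (a + n) ((r - j) * M)); symmetry; apply/eqP.
    rewrite -all_count; apply/allP => i; rewrite mem_iota => hi.
    by apply: tailC; rewrite /a /n in hi *; slia.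
  rewrite -count_cat -split_iota count_setE -sum_nat_const.
  by apply: leq_sum => d /few.
have cC : #|C| <= r by have := max_card (mem C); rewrite card_ord.
(* Hence #|C| + j - r is not truncated, and the kept and fresh colours number exactly [j]. *)
have tC : r - j <= #|C| by rewrite -(leq_pmul2r M0); slia.
have cCC : #|~: C| = r - #|C|.
  by have := cardsC C; rewrite card_ord; slia.
have h2 : count (hole D C) (iota a n) <= (#|C| + j - r) * M.
  have -> : #|C| + j - r = #|C| - (r - j) by slia.
  by rewrite mulnBl; slia.
have lt_j i : a <= i < a + n -> recolour M D a C i < j.
  move=> /(recolour_lt M0 h2); rewrite cCC; slia.
(* The shift by rM + 1 carries [1, n] onto the window, where [lt_j] rules out the default value. *)
pose E p : 'I_j := insubd (Ordinal j0) (recolour M D a C (p + r * M + 1)).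
have EE p : 1 <= p <= n -> E p = recolour M D a C (p + r * M + 1) :> nat.
  by move=> hp; rewrite val_insubd lt_j // /a; slia.
have [u [v [[su sv] ouv auv [cu cv] luv]]] := hJ E.
pose sh p := p + r * M + 1.
have shD s : size s = M.+1 -> sorted ltn s -> constant (map E s) ->
    (forall i, i \in s -> 1 <= i <= n) -> constant (map D (map sh s)).
  move=> ss os cs hs.
  have s0 : 0 < size s by rewrite ss.
  apply: (@constant_mapP _ _ _ (D (sh (head 0 s)))) => i hi.
  apply: (@recolour_mono r M D a C (map sh s) M0 _ _ _ _ _ _ hi
    (map_f sh (mem_head0 s0))).
  - by rewrite size_map ss.
  - rewrite map_inj_uniq; first exact: (sorted_uniq ltn_trans ltnn os).
    by move=> p q; rewrite /sh; slia.
  - by move=> _ /mapP[p /hs hp ->]; rewrite /a /sh; slia.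
  - move=> _ _ /mapP[p hp ->] /mapP[q hq ->].
    by rewrite /sh -!EE ?hs // (constant_map_eq cs hp hq).
have u0 : 0 < size u by rewrite su.
have v0 : 0 < size v by rewrite sv.
have ou : sorted ltn u.
  by move: ouv; rewrite (sorted_pairwise ltn_trans) pairwise_cat
    -!(sorted_pairwise ltn_trans) => /and3P[].
have ov : sorted ltn v.
  by move: ouv; rewrite (sorted_pairwise ltn_trans) pairwise_cat
    -!(sorted_pairwise ltn_trans) => /and3P[].
have last_sh s : 0 < size s -> last 0 (map sh s) = sh (last 0 s).
  by case: s => //= k s _; rewrite last_map.
have head_sh s : 0 < size s -> head 0 (map sh s) = sh (head 0 s) by case: s.
apply: hno; exists (map sh u), (map sh v); split.
- by rewrite !size_map.
- rewrite -map_cat sorted_map; apply: sub_sorted ouv => p q /=.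
  by rewrite /sh; slia.
- rewrite -map_cat all_map; apply: sub_all auv => p /=; rewrite /sh; slia.
- by split; apply: shD => // i hi; apply: (allP auv); rewrite mem_cat hi ?orbT.
- by rewrite !last_sh // head_sh // /sh; slia.
Qed.

(** * Balanced prefixes *)

Lemma size_sum_count (T : finType) (s : seq T) :
  size s = \sum_d count_mem d s.
Proof.
have -> : size s = count (fun d => d \in [set: T]) s.
  by rewrite -count_predT; apply: eq_count => d; rewrite /= in_setT.
by rewrite (count_setE id); apply: eq_bigl => d; rewrite inE.
Qed.

(* Keep the first [M] occurrences of each letter of [s]. *)
Lemma first_occurrences (T : eqType) M (s : seq T) : exists t : seq T,
  [/\ size t <= size s,
      forall d, count_mem d t = minn M (count_mem d s)
    & forall q d, minn M (count_mem d (take q s)) <= count_mem d (take q t)].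
Proof.
elim/last_ind: s => [|s a [t [st ct pt]]].
  by exists [::]; split=> // *; rewrite minn0.
(* A dropped letter has already reached its quota, and dropping only moves later letters to the
   left. *)
pose t' := if count_mem a s < M then rcons t a else t.
have ct' d : count_mem d t' = minn M (count_mem d (rcons s a)).
  rewrite /t' -[in RHS]cats1 count_cat /= addn0.
  by case: ifP => h; rewrite -?cats1 ?count_cat /= ct; case: eqP h => [<-|_] /=; lia.
have st' : size t' <= size (rcons s a).
  by rewrite /t'; case: ifP; rewrite !size_rcons; lia.
exists t'; split=> // q d.
case: (leqP q (size s)) => hq.
  rewrite -[rcons s a]cats1 takel_cat //; apply: leq_trans (pt q d) _.
  rewrite /t'; case: ifP => // _; rewrite -cats1 take_cat; case: ltnP => // h.
  by rewrite count_cat take_oversize // leq_addr.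
rewrite (take_oversize (_ : size (rcons s a) <= q)) ?size_rcons //.
by rewrite take_oversize ?ct' //; move: st'; rewrite size_rcons; lia.
Qed.

(** Padding [s] with [M] copies of each colour lifts every truncated count to [M]; prefixes with
    [q <= size s] do not see the padding. *)
Lemma balanced_prefix (T : finType) M (s : seq T) : exists t : seq T,
  [/\ size t = #|T| * M, forall d, count_mem d t = M
    & forall q d, q <= size s ->
        minn M (count_mem d (take q s)) <= count_mem d (take q t)].
Proof.
pose w := s ++ flatten [seq nseq M d | d <- enum T].
have [t [_ ct pt]] := first_occurrences M w.
have ctM d : count_mem d t = M.
  rewrite ct; apply/minn_idPl; rewrite count_cat; apply: leq_trans (leq_addl _ _).
  rewrite count_flatten -map_comp sumnE big_map big_enum (bigD1 d) //=.
  by rewrite count_nseq /= eqxx mul1n leq_addr.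
exists t; split=> //.
- by rewrite size_sum_count (eq_bigr _ (fun d _ => ctM d)) sum_nat_const.
- by move=> q d hq; have := pt q d; rewrite /w takel_cat.
Qed.

(** * The lower bound construction *)

Lemma size_le_block (M a e : nat) (s : seq nat) : 0 < M -> uniq s ->
  (forall i, i \in s -> a <= i /\ (i - a) %/ M = e) -> size s <= M.
Proof.
move=> M0 us h; rewrite -(size_iota (a + e * M) M).
apply: uniq_leq_size => // i /h[ai ie]; rewrite mem_iota.
have := divn_eq (i - a) M; have := ltn_pmod (i - a) M0; rewrite ie; lia.
Qed.

Lemma count_nth_iota (T : eqType) (x0 : T) (P : pred T) (s : seq T) q :
  q <= size s -> count (fun i => P (nth x0 s i)) (iota 0 q) = count P (take q s).
Proof.
by move=> hq; rewrite -[in RHS](mkseq_nth x0 s) /mkseq -map_take take_iota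
  (minn_idPl hq) count_map.
Qed.

(** With r = j + k + 1 the lengths are (r - 1)M and (3r - j - 1)M + 1, written without truncated
    subtraction. *)
Lemma avoidable_lower j k M : 0 < M -> ~ unavoidable M.+1 j ((j + k) * M) ->
  ~ unavoidable M.+1 (j + k.+1) ((2 * j + 3 * k + 2) * M + 1).
Proof.
move=> M0 /existsNP[A hA].
have [B [sB cB pB]] := balanced_prefix M [seq A i | i <- iota 1 ((j + k) * M)].
rewrite card_ord in sB; rewrite size_map size_iota in pB.
have j0 : 0 < j by apply: leq_ltn_trans (ltn_ord (A 0)).
pose b i := nth (Ordinal j0) B i.
(* [X + 1], [P + 1] and [Q + 1] will be the last positions of B, of the first run of blocks and of
   A. Abstracting the products leaves linear goals. *)
have [P PE] : exists P, P = (j + k.+1) * M by eexists.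
have [Q QE] : exists Q, Q = (2 * j + 2 * k + 1) * M by eexists.
have [N NE] : exists N, N = (2 * j + 3 * k + 2) * M + 1 by eexists.
have [X XE] : exists X, X = j * M by eexists.
have [Y YE] : exists Y, Y = k * M by eexists.
have LE : (j + k) * M = X + Y by slia.
rewrite -NE; rewrite LE in hA pB; rewrite -XE in sB.
have {}NE : N = Q + Y + M + 1 by slia.
have {}QE : Q = P + X + Y by slia.
have {}PE : P = X + Y + M by slia.
clear LE XE.
(* Colours count from 0: those below [j] belong to [A], and j + k is shared by position 1 and the
   last block of each run. *)
pose f p : nat :=
  if p <= 1 then j + k else if p <= X + 1 then b (p - 2) : nat
  else if p <= P + 1 then j + (p - (X + 2)) %/ M
  else if p <= Q + 1 then A (p - (P + 1)) : nat else j + (p - (Q + 2)) %/ M.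
have r0 : 0 < j + k.+1 by rewrite addnS.
have f_lt p : p <= N -> f p < j + k.+1.
  move=> pN; rewrite /f.
  have := ltn_ord (b (p - 2)); have := ltn_ord (A (p - (P + 1))) => hAp hb.
  case: ifP => _; first slia.
  case: ifP => h1; first slia.
  case: ifP => h2.
    by rewrite ltn_add2l ltn_divLR // mulSn -YE; slia.
  case: ifP => h3; first slia.
  by rewrite ltn_add2l ltn_divLR // mulSn -YE; slia.
pose D p : 'I_(j + k.+1) := insubd (Ordinal r0) (f p).
have DE p : p <= N -> D p = f p :> nat by move=> /f_lt h; rewrite val_insubd h.
have fJ p : f p < j -> 2 <= p <= X + 1 \/ P + 2 <= p <= Q + 1.
  rewrite /f; move: ((p - (X + 2)) %/ M) ((p - (Q + 2)) %/ M) => u v.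
  by do ?[case: ifP => ?]; slia.
have fB p : 2 <= p <= X + 1 -> f p = b (p - 2).
  by move=> hp; rewrite /f; do ?[case: ifP => ?]; slia.
have fA p : P + 2 <= p <= Q + 1 -> f p = A (p - (P + 1)).
  by move=> hp; rewrite /f; do ?[case: ifP => ?]; slia.
have fC p : j <= f p -> p <= P + 1 ->
    p <= 1 /\ f p = j + k
    \/ X + 2 <= p /\ (p - (X + 2)) %/ M = f p - j.
  rewrite /f; have := ltn_ord (b (p - 2)).
  move: ((p - (X + 2)) %/ M) ((p - (Q + 2)) %/ M) => u v.
  by do ?[case: ifP => ?]; slia.
have fZ p : j <= f p -> P + 2 <= p -> Q + 2 <= p /\ (p - (Q + 2)) %/ M = f p - j.
  rewrite /f; have := ltn_ord (A (p - (P + 1))).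
  move: ((p - (X + 2)) %/ M) ((p - (Q + 2)) %/ M) => u v.
  by do ?[case: ifP => ?]; slia.
have sizeB (s : seq nat) (d : 'I_j) lo : uniq s -> 2 <= lo <= X + 2 ->
    (forall i, i \in s -> lo <= i <= X + 1 /\ f i = d) ->
    size s + count_mem d (take (lo - 2) B) <= M.
  move=> us hlo hs; rewrite -[leqRHS](cB d) -[in leqRHS](take_size B) sB.
  rewrite -!(count_nth_iota (Ordinal j0)) ?sB //; last slia.
  have -> : X = (lo - 2) + (X + 2 - lo) by slia.
  rewrite iotaD count_cat addnC leq_add2l -(size_map (subn^~ 2)).
  apply: size_le_count.
    by rewrite map_inj_in_uniq // => p q /hs ? /hs ?; slia.
  move=> _ /mapP[p /hs[hp fp] ->]; split; first slia.
  by apply/eqP/val_inj; rewrite /= -fp fB //; slia.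
move=> /(_ D)[x [y [[sx sy] oxy axy [cx cy] lxy]]].
have x0 : 0 < size x by rewrite sx.
have y0 : 0 < size y by rewrite sy.
move: (oxy); rewrite (sorted_pairwise ltn_trans) pairwise_cat.
rewrite -!(sorted_pairwise ltn_trans) => /and3P[/allrelP ltxy ox oy].
have ux : uniq x by exact: (sorted_uniq ltn_trans ltnn ox).
have uy : uniq y by exact: (sorted_uniq ltn_trans ltnn oy).
have hx := mem_head0 x0; have lx := mem_last0 x0.
have hy := mem_head0 y0; have ly := mem_last0 y0.
have xN i : i \in x -> 1 <= i <= N.
  by move=> hi; apply: (allP axy); rewrite mem_cat hi.
have yN i : i \in y -> 1 <= i <= N.
  by move=> hi; apply: (allP axy); rewrite mem_cat hi orbT.
have fx i : i \in x -> f i = f (head 0 x).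
  move=> hi; have /andP[_ iN] := xN _ hi; have /andP[_ hN] := xN _ hx.
  by rewrite -(DE i) // -DE // (constant_map_eq cx hi hx).
have fy i : i \in y -> f i = f (head 0 y).
  move=> hi; have /andP[_ iN] := yN _ hi; have /andP[_ hN] := yN _ hy.
  by rewrite -(DE i) // -DE // (constant_map_eq cy hi hy).
have xb i : i \in x -> head 0 x <= i <= last 0 x.
  by move=> hi; rewrite sorted_ltn_head ?sorted_ltn_last.
have yb i : i \in y -> head 0 y <= i <= last 0 y.
  by move=> hi; rewrite sorted_ltn_head ?sorted_ltn_last.
have hxy := ltxy _ _ lx hy.
(* No colour occurs more than [M] times in [1, P]. *)
have xP : P + 1 <= last 0 x.
  rewrite leqNgt; apply/negP => xP; suff : size x <= M by rewrite sx ltnn.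
  case: (ltnP (f (head 0 x)) j) => hd.
    have := @sizeB x (Ordinal hd) 2 ux; rewrite subnn take0 addn0; apply; first slia.
    move=> i hi; have := xb _ hi; have := fJ i; rewrite (fx i hi) => /(_ hd).
    by split=> //; slia.
  have fCx i : i \in x -> i <= 1 /\ f (head 0 x) = j + k \/ X + 2 <= i /\
      (i - (X + 2)) %/ M = f (head 0 x) - j.
    by move=> hi; rewrite -(fx i hi); apply: fC; rewrite ?fx //; have := xb _ hi; slia.
  (* Colour j + k has the extra point 1, but its block ends at [P + 1], which leaves [M.-1] of its
     points in [2, P]. *)
  case: (eqVneq (f (head 0 x)) (j + k)) => [dE|/eqP dE].
    rewrite -(prednK M0) -(size_iota (P + 2 - M) M.-1) -[_.+1]/(size (1 :: _)).
    apply: uniq_leq_size => // i hi; rewrite inE mem_iota.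
    have := xN _ hi; have := xb _ hi; case: (fCx _ hi) => [|[i1]]; first slia.
    rewrite dE addKn => i2; have := divn_eq (i - (X + 2)) M.
    by rewrite i2 -YE; have := ltn_pmod (i - (X + 2)) M0; slia.
  apply: (@size_le_block M (X + 2) (f (head 0 x) - j)) => // i /fCx; slia.
(* [y] starts after [P + 1], where a colour from [j] on has only the [M] points of its block behind
   A. *)
have fyJ : f (head 0 y) < j.
  rewrite ltnNge; apply/negP => hd; suff : size y <= M by rewrite sy ltnn.
  apply: (@size_le_block M (Q + 2) (f (head 0 y) - j)) => // i hi.
  rewrite -(fy i hi); apply: fZ; first by rewrite fy.
  by have := yb _ hi; slia.
have yA i : i \in y -> P + 2 <= i <= Q + 1.
  by move=> hi; have := fJ i; rewrite (fy i hi) => /(_ fyJ); have := yb _ hi; slia.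
have := yA _ ly; have := yA _ hy => hyQ lyQ.
case: (ltnP (f (head 0 x)) j) => hd; last first.
  have xP1 i : i \in x -> i <= P + 1.
    move=> hi; rewrite leqNgt; apply/negP => lt.
    have := fZ i; rewrite (fx i hi) => /(_ hd); have := xb _ hi; slia.
  (* If [x] starts at 1, then 2(x_m - 1) >= 2P = Q + M, which exceeds y_m - 1. *)
  case: (leqP (head 0 x) 1) => h1.
    by move: lxy; have := xP1 _ lx; slia.
  suff : size x <= M by rewrite sx ltnn.
  apply: (@size_le_block M (X + 2) (f (head 0 x) - j)) => // i hi.
  have := fC i; rewrite (fx i hi) => /(_ hd (xP1 _ hi)); have := xb _ hi; slia.
have xJ i : i \in x -> 2 <= i <= X + 1 \/ P + 2 <= i <= Q + 1.
  by move=> hi; apply: fJ; rewrite fx.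
(* If [x] starts in A, translating by [P + 1] yields a pair for [A]. *)
case: (leqP (P + 2) (head 0 x)) => hP.
  have xA i : i \in x -> P + 2 <= i <= Q + 1 by move=> hi; have := xb _ hi; slia.
  pose sh p := p - (P + 1).
  have last_sh s : 0 < size s -> last 0 (map sh s) = sh (last 0 s).
    by case: s => //= p s _; rewrite last_map.
  have head_sh s : 0 < size s -> head 0 (map sh s) = sh (head 0 s) by case: s.
  have xyA i : i \in x ++ y -> P + 2 <= i <= Q + 1.
    by rewrite mem_cat => /orP[/xA|/yA].
  apply: hA; exists (map sh x), (map sh y); split.
  - by rewrite !size_map.
  - rewrite -map_cat sorted_map; apply: (sub_in_sorted _ _ oxy (P := mem (x ++ y))).
      by move=> p q /xyA hp /xyA hq /=; rewrite /sh; slia.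
    exact/allP.
  - by rewrite -map_cat all_map; apply/allP => p /xyA /=; rewrite /sh; slia.
  - split.
      apply: (@constant_mapP _ _ _ (Ordinal hd)) => _ /mapP[p hp ->].
      by apply: val_inj; rewrite /= -(fx p hp) fA ?xA.
    apply: (@constant_mapP _ _ _ (Ordinal fyJ)) => _ /mapP[p hp ->].
    by apply: val_inj; rewrite /= -(fy p hp) fA ?yA.
  - by rewrite !last_sh // head_sh // /sh; have := xA _ hx; slia.
(* If the first point of x is the n-th occurrence of its colour in B, then x
   has at least n points in the copy of A, so it ends no earlier in that copy
   than it starts in B. *)
pose h := head 0 x; pose d := Ordinal hd.
have hB : 2 <= h <= X + 1 by case: (xJ _ hx); rewrite -/h; slia.
have s1 := @sizeB [seq i <- x | i <= P + 1] d h (filter_uniq _ ux).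
have s2 := count_predC (fun i => i <= P + 1) x.
have {}s1 : size [seq i <- x | i <= P + 1] + count_mem d (take (h - 2) B) <= M.
  apply: s1 => [|i]; first slia.
  rewrite mem_filter => /andP[h1 hi]; split; last exact: fx.
  by have := xJ _ hi; have := xb _ hi; rewrite -/h; slia.
have n0 : 0 < count (fun i => i <= P + 1) x.
  by rewrite -has_count; apply/hasP; exists h => //; rewrite -/h in hP; slia.
pose q := last 0 x - (P + 1).
have hq : q <= (X + Y) by rewrite /q; slia.
have s3 : count (predC (fun i => i <= P + 1)) x <=
    count_mem d (take q [seq A i | i <- iota 1 ((X + Y))]).
  rewrite -map_take take_iota (minn_idPl hq) count_map -size_filter.
  rewrite -(size_map (subn^~ (P + 1))); apply: size_le_count.
    rewrite map_inj_in_uniq ?filter_uniq // => p p'.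
    by rewrite !mem_filter /= => ? ?; slia.
  move=> _ /mapP[p + ->]; rewrite mem_filter /= -ltnNge => /andP[h1 hp].
  have := xb _ hp; have := xJ _ hp => hp1 hp2; split; first by rewrite /q; slia.
  by apply/eqP/val_inj; rewrite /= -(fx p hp) fA //; slia.
(* Let n be the number of points of [x] up to [P + 1]. Colour [d] occurs at most M - n times before
   [h] in B, but at least M + 1 - n times among the first [q] terms of A; q <= h - 2 would
   contradict [pB]. *)
have hqh : h - 2 < q.
  rewrite ltnNge; apply/negP => hle; rewrite size_filter in s1.
  have le_t : count_mem d (take q B) <= count_mem d (take (h - 2) B).
    by rewrite -(subnKC hle) takeD count_cat leq_addr.
  have := leq_trans (pB q d hq) le_t; apply/negP; rewrite -ltnNge leq_min.
  apply/andP; split; first by apply: leq_trans s1; rewrite -add1n leq_add2r.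
  apply: leq_trans s3; rewrite -(ltn_add2l (count (fun i => i <= P + 1) x)).
  by rewrite s2 sx ltnS.
(* Now x_m >= P + h, so 2 x_m - x_1 >= 2P + h > Q + 1 >= y_m. *)
by move: lxy; rewrite -/h /q in hqh *; slia.
Qed.

(** * Combining the two bounds *)

Theorem theorem4p5 (j r m0 : nat) (hj : 0 < j) (hr : 0 < r) (hm0 : 0 < m0)
    (hjr : j < r)
    (hg : forall m : nat, m0 <= m -> 2 <= m ->
       (r - 1) * (m - 1) + 1 <= g m j < r * (m - 1)) :
  forall m : nat, m0 <= m -> 2 <= m ->
    (3 * r - j - 1) * (m - 1) + 1 < g m r <= (3 * r - j) * (m - 1).
Proof.
move=> [//|M] hm M0; have := hg M.+1 hm M0.
have -> : M.+1 - 1 = M by rewrite subn1.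
move=> /andP[hlo hup].
apply/andP; split.
  rewrite ltnNge; apply/negP => hle.
  have := unavoidable_widen hle (@unavoidable_g _ _).
  have [k rE] : exists k, r = j + k.+1 by exists (r - j.+1); lia.
  have -> : 3 * r - j - 1 = 2 * j + 3 * k + 2 by lia.
  rewrite rE; apply: avoidable_lower => // hJ.
  have : g M.+1 j <= (j + k) * M by apply: g_le => //; nia.
  by move: hlo; rewrite rE addnS subn1 /=; lia.
apply: g_le; first nia.
apply: unavoidable_upper => //; first exact: ltnW.
by apply: unavoidable_widen (@unavoidable_g _ _); lia.
Qed.
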